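(* For a real number $x$ let $\mathcal{P}_x^\infty=\{nx \pmod 1 : n\in\mathbb{Z}\}\subset\mathbb{R}/\mathbb{Z}$. (i) Let $x$ be irrational and let $y$ be a real number. Then there exists $\tau\in\mathbb{R}/\mathbb{Z}$ with $\mathcal{P}_x^\infty=\tau+\mathcal{P}_y^\infty$ if and only if $x=y\pmod 1$ or $x=-y\pmod 1$. (ii) Let $x=a/b$ be rational, with $a,b$ coprime integers and $b>0$. Then there are exactly $\Phi(b)$ different generators, i.e. exactly $\Phi(b)$ elements $y\in\mathbb{R}/\mathbb{Z}$ such that $\mathcal{P}_x^\infty=\tau+\mathcal{P}_y^\infty$ for some $\tau\in\mathbb{R}/\mathbb{Z}$.
   Context: $\Phi$ is Euler's totient function. The set $\mathcal{P}_y^\infty$ depends only on $y$ modulo $1$, so it is well defined for $y\in\mathbb{R}/\mathbb{Z}$. *)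

(* Defs.v *)
From mathcomp Require Import all_boot all_order all_algebra.
From mathcomp Require Import all_classical all_reals.

Set Implicit Arguments.
Unset Strict Implicit.
Unset Printing Implicit Defensive.
Import Order.TTheory GRing.Theory Num.Theory.
Local Open Scope classical_set_scope.
Local Open Scope ring_scope.
Local Open Scope quotient_scope.

(* The group R/Z: ring_quotient's quotient of the additive group R by its
   subgroup of integers ([Num.int_num_subdef] is the predicate carrying the
   closure instances of [Num.int]); [mod1_eqP] below gives its equality. *)
Definition circle (R : realType) : zmodType :=
  Quotient.quot (GRing.ZmodClosed.clone R Num.int_num_subdef _).

Definition mod1 (R : realType) (x : R) : circle R := \pi_(circle R) x.

Definition Pinf (R : realType) (x : R) : set (circle R) :=
  [set mod1 (n%:~R * x) | n in [set: int]].

(* [Pinf] descends to R/Z; independence of the representative is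
   [Pinf_circle_mod1] below. *)
Definition Pinf_circle (R : realType) (y : circle R) : set (circle R) :=
  Pinf (repr y).

Definition translate (V : zmodType) (t : V) (A : set V) : set V :=
  [set t + z | z in A].

Lemma mod1_eqP (R : realType) (x y : R) :
  mod1 x = mod1 y <-> exists n : int, x - y = n%:~R.
Proof.
rewrite /mod1; split => [/eqP|]; first by rewrite -Quotient.idealrBE => /intrP.
by move=> xy; apply/eqP; rewrite -Quotient.idealrBE; apply/intrP.
Qed.

Lemma mod1D (R : realType) (x y : R) : mod1 (x + y) = mod1 x + mod1 y.
Proof. exact: (raddfD (\pi_(circle R))). Qed.

Lemma Pinf_mod1_eq (R : realType) (x y : R) : mod1 x = mod1 y -> Pinf x = Pinf y.
Proof.
have sub (u v : R) : mod1 u = mod1 v -> Pinf u `<=` Pinf v.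
  move=> /mod1_eqP[m uv] _ [n _ <-]; exists n => //.
  apply/esym/mod1_eqP; exists (n * m).
  by rewrite -mulrBr uv intrM.
by move=> xy; apply/seteqP; split; apply: sub.
Qed.

Lemma Pinf_circle_mod1 (R : realType) (x : R) : Pinf_circle (mod1 x) = Pinf x.
Proof. by apply: Pinf_mod1_eq; rewrite /mod1 reprK. Qed.

(* Main.v *)
Require Import Defs.
From mathcomp Require Import all_boot all_order all_algebra.
From mathcomp Require Import all_classical all_reals.
From mathcomp Require Import finmap.

Set Implicit Arguments.
Unset Strict Implicit.
Unset Printing Implicit Defensive.
Import Order.TTheory GRing.Theory Num.Theory.
Local Open Scope classical_set_scope.
Local Open Scope card_scope.
Local Open Scope ring_scope.

(** [Pinf x] is the cyclic subgroup of R/Z generated by the class of [x]. A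
    translate of a subgroup that contains 0 is that subgroup, so [tau] can be
    dropped, and both parts ask when two elements of an abelian group generate
    the same cyclic subgroup ([translate_multiples]).

    If [g] has order [b], with [b = 0] standing for infinite order, then the
    generators of the subgroup of [g] are the multiples [g *~ n] with [n]
    coprime to [b] ([eq_multiplesP]): Bezout coefficients of [n] and [b] are
    exactly what is needed to recover [g] from [g *~ n].
    - For irrational [x] the order is 0; the integers coprime to 0 are 1 and
      -1, which gives (i).
    - For [x = a / b] in lowest terms the order is [b]; the generators
      correspond to the residues modulo [b] that are coprime to [b]
      ([card_cyclic_generators]), which gives (ii). *)

Definition multiples (V : zmodType) (g : V) : set V :=
  [set g *~ n | n in [set: int]].

(** An additive order with the value 0 for elements of infinite order, since
    [(0 %| n)%Z] means [n = 0]; finite and infinite cyclic groups are then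
    treated together. *)
Definition has_order (V : zmodType) (g : V) (b : nat) : Prop :=
  forall n : int, g *~ n = 0 <-> (b %| n)%Z.

(** [0] lies in the subgroup of [g], hence in the coset [t + <h>], so that
    this coset is [<h>] itself. *)
Lemma translate_multiples (V : zmodType) (g h : V) :
  (exists t, multiples g = translate t (multiples h)) <->
  multiples g = multiples h.
Proof.
split=> [[t gth]|gh]; last first.
  exists 0; rewrite gh; apply/seteqP; split=> z.
    by exists z; rewrite ?add0r.
  by move=> [w ? <-]; rewrite add0r.
have [_ [m _ <-] /eqP] : translate t (multiples h) 0.
  by rewrite -gth; exists 0; rewrite ?mulr0z.
rewrite addr_eq0 => /eqP tE; rewrite gth tE.
apply/seteqP; split=> z.
  by move=> [_ [n _ <-] <-]; exists (n - m) => //; rewrite mulrzBr addrC.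
move=> [n _ <-]; exists (h *~ (n + m)); first by exists (n + m).
by rewrite mulrzDr addrC addrK.
Qed.

Lemma sub_multiples (V : zmodType) (g : V) (n : int) :
  multiples (g *~ n) `<=` multiples g.
Proof. by move=> _ [m _ <-]; exists (n * m); rewrite ?mulrzA. Qed.

(** If [h = g *~ n] and [g = h *~ m], then [b] divides [n * m - 1], which is a
    Bezout relation for [b] and [n]; conversely a Bezout relation
    [u * b + v * n = 1] gives [g = g *~ n *~ v]. *)
Lemma eq_multiplesP (V : zmodType) (g h : V) (b : nat) : has_order g b ->
  multiples g = multiples h <-> exists2 n : int, coprimez b n & h = g *~ n.
Proof.
move=> gb; split=> [gh|[n /coprimezP[[u v] /= uv] ->]].
  have [n _ hE] : multiples g h by rewrite gh; exists 1.
  have [m _ gE] : multiples h g by rewrite -gh; exists 1.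
  exists n => //; apply/coprimezP.
  have /gb/dvdzP[k kE] : g *~ (n * m - 1) = 0.
    by rewrite mulrzBr mulrzA hE gE subrr.
  by exists (- k, m); rewrite /= mulNr -kE (mulrC m) opprB subrK.
have gE : g = g *~ n *~ v.
  rewrite -mulrzA -[LHS]mulr1z -uv mulrzDr (mulrC v).
  by rewrite (proj2 (gb _)) ?add0r // dvdz_mull.
apply/seteqP; split; last exact: sub_multiples.
by rewrite {1}gE; apply: sub_multiples.
Qed.

Lemma card_coprime_residues (b : nat) :
  [set k | (k < b)%N && coprime b k] #= `I_(totient b).
Proof.
pose s := [seq k <- iota 0 b | coprime b k].
have -> : [set k | (k < b)%N && coprime b k] = [set` [fset k in s]%fset].
  by apply/seteqP; split=> k; rewrite /= !inE mem_filter mem_iota add0n andbC.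
apply/card_eq_fsetP.
rewrite card_fseq undup_id ?filter_uniq ?iota_uniq // size_filter -sum1_count.
rewrite totient_count_coprime big_mkcond /index_iota subn0.
by apply: eq_bigr => k _; case: coprime.
Qed.

(** Reduction modulo [b] makes the coefficient [n] of [eq_multiplesP] a
    residue in [0 .. b - 1], and distinct residues give distinct multiples. *)
Lemma card_cyclic_generators (V : zmodType) (g : V) (b : nat) :
  (0 < b)%N -> has_order g b ->
  [set h | multiples g = multiples h] #= `I_(totient b).
Proof.
move=> b0 gb.
suff -> : [set h | multiples g = multiples h] =
    (fun k : nat => g *~ k) @` [set k | (k < b)%N && coprime b k].
  apply: card_eq_trans (card_coprime_residues b); apply: inj_card_eq.
  move=> k l /set_mem /andP[kb _] /set_mem /andP[lb _] kl.
  have /gb : g *~ (k%:Z - l%:Z) = 0 by rewrite mulrzBr kl subrr.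
  by rewrite -eqz_mod_dvd !modz_small // => /eqP[].
apply/seteqP; split=> h /=; last first.
  by move=> [k /andP[_ bk] <-]; apply/(eq_multiplesP _ gb); exists k.
move=> /(eq_multiplesP _ gb)[n bn ->].
have bZ0 : b%:Z != 0 by rewrite eqz_nat -lt0n.
have modE : `|(n %% b)%Z|%N%:Z = (n %% b)%Z by rewrite gez0_abs ?modz_ge0.
exists `|(n %% b)%Z|%N.
  rewrite -ltz_nat modE ltz_pmod //=.
  by move: bn; rewrite /coprimez -gcdz_modr -modE.
apply/eqP; rewrite -subr_eq0 -mulrzBr; apply/eqP/gb.
by rewrite modE -eqz_mod_dvd modz_mod.
Qed.

Lemma mod1_mulz (R : realType) (n : int) (x : R) : mod1 (n%:~R * x) = mod1 x *~ n.
Proof. by rewrite mulrzl; apply: (raddfMz (\pi_(circle R)%qT)). Qed.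

Lemma PinfE (R : realType) (x : R) : Pinf x = multiples (mod1 x).
Proof. by apply/seteqP; split=> _ [n _ <-]; exists n => //; rewrite mod1_mulz. Qed.

Lemma Pinf_circleE (R : realType) (y : circle R) : Pinf_circle y = multiples y.
Proof. by rewrite /Pinf_circle PinfE /mod1 reprK. Qed.

Lemma mod1_mulz_eq0 (R : realType) (n : int) (x : R) :
  mod1 x *~ n = 0 <-> exists m : int, n%:~R * x = m%:~R.
Proof.
have <- : mod1 (0 : R) = 0 by apply: (raddf0 (\pi_(circle R)%qT)).
by rewrite -mod1_mulz mod1_eqP; split=> -[m mE]; exists m; move: mE; rewrite subr0.
Qed.

Lemma irrational_has_order (R : realType) (x : R) :
  irrational x -> has_order (mod1 x) 0.
Proof.
move=> irrx n; rewrite mod1_mulz_eq0 dvd0z; split=> [[m nx]|/eqP->]; last first.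
  by exists 0; rewrite mul0r.
have [//|n0] := eqVneq n 0; case: irrx.
exists (m%:~R / n%:~R) => //.
by rewrite fmorph_div /= !ratr_int -nx mulrAC mulfV ?mul1r // intr_eq0.
Qed.

(** [n * a / b] is an integer exactly when [b] divides [a * n], that is, [a]
    being coprime to [b], when [b] divides [n]. *)
Lemma rational_has_order (R : realType) (a : int) (b : nat) :
  (0 < b)%N -> coprimez a b ->
  has_order (mod1 (a%:~R / b%:~R : R)) b.
Proof.
move=> b0 ab n; rewrite mod1_mulz_eq0.
have bR : b%:~R != 0 :> R by rewrite intr_eq0 eqz_nat -lt0n.
have eqE (m : int) : n%:~R * (a%:~R / b%:~R) = m%:~R :> R <-> a * n = m * b.
  split=> nx; last by rewrite mulrA -intrM (mulrC n) nx intrM mulfK.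
  by apply/(@intr_inj R); rewrite !intrM -nx mulrA mulfVK // mulrC.
rewrite -(@Gauss_dvdzr b a n) 1?coprimez_sym //.
by split=> [[m /eqE mE]|/dvdzP[m /eqE mE]]; [apply/dvdzP|]; exists m.
Qed.

Theorem theorem8 (R : realType) :
  (forall x y : R, irrational x ->
     (exists tau : circle R, Pinf x = translate tau (Pinf y)) <->
     (mod1 x = mod1 y \/ mod1 x = mod1 (- y)))
  /\
  (forall (x : R) (a b : int), coprimez a b -> 0 < b -> x = a%:~R / b%:~R ->
     [set y : circle R |
        exists tau : circle R, Pinf x = translate tau (Pinf_circle y)]
     #= `I_(totient `|b|%N)).
Proof.
split=> [x y irrx|x a [] // b ab b0 ->].
  rewrite !PinfE translate_multiples (eq_multiplesP _ (irrational_has_order irrx)).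
  have -> : mod1 (- y) = - mod1 y by rewrite -mulN1r (mod1_mulz (-1)) mulrN1z.
  split=> [[n n1 ->]|[->|->]]; [|by exists 1|by exists (-1); rewrite // mulrN1z opprK].
  (* [coprimez 0 n] reduces to [`|n| = 1] *)
  move: n1; rewrite /coprimez /gcdz /= gcd0n => /eqP[] n1.
  by case: (intP n) n1 => [|m|m] //= [->]; [left|right; rewrite mulrN1z opprK].
have -> : [set y | exists tau,
      Pinf (a%:~R / b%:~R : R) = translate tau (Pinf_circle y)]
    = [set y | multiples (mod1 (a%:~R / b%:~R : R)) = multiples y].
  by apply/seteqP; split=> y /=; rewrite PinfE Pinf_circleE translate_multiples.
exact/card_cyclic_generators/rational_has_order.
Qed.
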